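(* There is an absolute constant $c>0$ such that for every positive integer $N$ the following hold. (i) There exists a set $A\subseteq[N]$ with $|A|\geq cN^{1/2}$ such that no non-zero difference $a-a'$ ($a,a'\in A$) lies in $\{x^2+y^2: x,y\in\mathbb{Z}\}$. (ii) There exists a set $A\subseteq[N]$ with $|A|\geq cN^{1/4}$ such that no non-zero difference $a-a'$ ($a,a'\in A$) lies in $\{x_1^4+\dots+x_7^4: x_1,\dots,x_7\in\mathbb{Z}\}$.
   Context: $[N]=\{1,2,\dots,N\}$. *)

(* Defs.v *)
From mathcomp Require Import all_boot all_order all_algebra finmap.
From mathcomp Require Import classical_sets reals exp.
Import Order.TTheory GRing.Theory Num.Theory.

Set Implicit Arguments.
Unset Strict Implicit.
Unset Printing Implicit Defensive.

Local Open Scope ring_scope.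
Local Open Scope classical_set_scope.

Definition int_interval (N : nat) : set int :=
  [set m : int | (1 <= m <= N%:Z)].

Definition sums_of_two_squares : set int :=
  [set n : int | exists x y : int, n = x ^+ 2 + y ^+ 2].

Definition sums_of_seven_fourth_powers : set int :=
  [set n : int | exists x : 'I_7 -> int, n = \sum_(i < 7) x i ^+ 4].

Definition avoids_nonzero_differences (A : {fset int}) (S : set int) : Prop :=
  forall a a' : int, a \in A -> a' \in A -> a - a' <> 0 -> ~ S (a - a').

(* Main.v *)
(* If every element of S divisible by t is tD times an element of S, then a
   non-zero element of S has the form (tD)^k m with t not dividing m.  Two
   distinct integers whose base-tD digits are all multiples of t differ by a
   number (tD)^k t e with D not dividing e, which is therefore never in S.
   Since D^r = tD, the set of such integers up to N has about N^(1/r) elements.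
   Two squares: t = D = 3, as 3 | x^2 + y^2 forces 3 | x, y.
   Seven fourth powers: t = 8, D = 2, as x^4 is 0 or 1 modulo 8, so that a sum of
   seven fourth powers divisible by 8 has only even terms. *)
Require Import Defs.
From mathcomp Require Import all_boot all_order all_algebra finmap.
From mathcomp Require Import classical_sets reals exp.
From mathcomp Require Import zify ring lra.
Import Order.TTheory GRing.Theory Num.Theory.

Local Open Scope ring_scope.
Local Open Scope classical_set_scope.

Definition descends (S : set int) (t D : nat) : Prop :=
  forall n : int, S (t%:Z * n) -> exists2 m, S m & n = D%:Z * m.

Lemma two_squares_descend : descends sums_of_two_squares 3 3.
Proof.
move=> n [x [y E]].
set q := (x %/ 3)%Z; set q' := (y %/ 3)%Z.
have [r xE] : exists r : int, x = 3 * q + r /\ (r == 0) || (r == 1) || (r == 2).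
  by exists (x %% 3)%Z; rewrite /q; lia.
have [r' yE] : exists r : int, y = 3 * q' + r /\ (r == 0) || (r == 1) || (r == 2).
  by exists (y %% 3)%Z; rewrite /q'; lia.
(* Modulo 3 only the remainders survive; among the squares 0, 1, 4 two add up to a multiple of 3
   only as 0 + 0. *)
have E3 : 3 * (n - 3 * q ^+ 2 - 2 * q * r - 3 * q' ^+ 2 - 2 * q' * r')
    = r ^+ 2 + r' ^+ 2.
  by move: E; rewrite xE.1 yE.1; lia.
have [r0 r'0] : r = 0 /\ r' = 0.
  move: xE.2 yE.2 E3 => /orP[/orP[]|] /eqP-> /orP[/orP[]|] /eqP->; lia.
exists (q ^+ 2 + q' ^+ 2); first by exists q, q'.
by move: E3; rewrite r0 r'0; lia.
Qed.

Lemma fourth_power_mod8 (x : int) :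
  exists w : int, x ^+ 4 = (odd `|x|%N)%:Z + 8 * w.
Proof.
have [q] : exists q : int, x = 2 * q + (odd `|x|%N)%:Z.
  by exists (x %/ 2)%Z; lia.
case: odd => -> /=; last by exists (2 * q ^+ 4); ring.
by exists (2 * q ^+ 4 + 4 * q ^+ 3 + 3 * q ^+ 2 + q); ring.
Qed.

Lemma seven_fourth_powers_descend : descends sums_of_seven_fourth_powers 8 2.
Proof.
move=> n [x E].
have /(@fin_all_exists _ (fun=> int)) [w Ew] := fun i => fourth_power_mod8 (x i).
(* [s] counts the odd terms and is the residue of the sum modulo 8; with seven terms it cannot reach
   8. *)
pose s := (\sum_(i < 7) odd `|x i|)%N.
have s_lt8 : (s < 8)%N.
  apply: (@leq_ltn_trans (\sum_(i < 7) 1)%N); last by rewrite sum1_card card_ord.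
  by apply: leq_sum => i _; case: odd.
have s0 : s = 0%N.
  have : 8 * n = s%:Z + 8 * \sum_(i < 7) w i.
    rewrite [LHS]E (eq_bigr _ (fun i _ => Ew i)) big_split /= -mulr_sumr.
    by rewrite /s (big_morph Posz PoszD (erefl _)).
  lia.
have x_even i : x i = 2 * (x i %/ 2)%Z.
  have : (odd `|x i|%N : nat) = 0%N.
    by apply/eqP; move/eqP: s0; rewrite sum_nat_eq0 => /forallP /(_ i).
  lia.
exists (\sum_(i < 7) (x i %/ 2)%Z ^+ 4); first by exists (fun i => (x i %/ 2)%Z).
have : 8 * n = 16 * \sum_(i < 7) (x i %/ 2)%Z ^+ 4.
  rewrite [LHS]E mulr_sumr; apply: eq_bigr => i _.
  by rewrite {1}x_even exprMn.
lia.
Qed.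

Section Digits.
Variables (S : set int) (t D : nat).
Hypotheses (t_gt0 : (0 < t)%N) (D_gt0 : (0 < D)%N) (S0 : S 0) (St : descends S t D).

(** Descent makes [D] divide [d - d'], whose absolute value is below [D]. *)
Lemma descends_digits (d d' : 'I_D) (z : int) :
  S (t%:Z * (D%:Z * z + (d%:Z - d'%:Z))) -> d = d' /\ S z.
Proof.
move=> /St[m Sm E].
have zm : z = m by have := ltn_ord d; have := ltn_ord d'; nia.
by split; [apply: val_inj => /=; nia | rewrite zm].
Qed.

(** Induction appends a lowest digit. If a difference lies in [S], [descends_digits] equates the
    last digits and puts the difference of the leading parts in [S], against the induction
    hypothesis. *)
Lemma digit_set (k : nat) :
  exists A : {fset int},
    [/\ [set` A] `<=` int_interval ((t * D) ^ k),
        #|` A| = (D ^ k)%N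
      & avoids_nonzero_differences A S].
Proof.
elim: k => [|k [A [Asub cardA Aavoid]]].
  exists [fset 1]%fset; split; last first.
  - by move=> a a'; rewrite !inE => /eqP-> /eqP->; rewrite subrr.
  - by rewrite cardfs1.
  - by move=> a /=; rewrite !inE => /eqP->.
(* Subtracting the digit keeps the values within [1, (tD)^(k+1)]. *)
pose f (p : int * 'I_D) : int := (t * D)%:Z * p.1 - t%:Z * p.2%:Z.
have fB p q : f p - f q = t%:Z * (D%:Z * (p.1 - q.1) + (q.2%:Z - p.2%:Z)).
  by rewrite /f PoszM; ring.
have f_inj : injective f.
  move=> [a d] [a' d'] E; have /= := fB (a, d) (a', d'); rewrite E subrr => E0.
  (* Equal values differ by 0, which lies in [S], so the same lemma applies. *)
  have [dd _] := @descends_digits d' d (a - a') (eq_ind _ S S0 _ E0).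
  move/esym/eqP: E0; rewrite dd subrr addr0 !mulf_eq0 subr_eq0.
  by move=> /or3P[||/eqP-> //]; lia.
exists [fset x in [seq f (a, d) | a <- A, d <- enum 'I_D]]%fset; split.
- move=> x /=; rewrite inE => /allpairsP[[a d] /= [aA _ ->]].
  have /= := Asub a aA; rewrite /int_interval /f /= expnS.
  have := ltn_ord d; set B := ((t * D) ^ k)%N => dD /andP[a1 aB].
  have : (t * d < t * D)%N by rewrite ltn_pmul2l.
  set td := (t * d)%N; have -> : t%:Z * (d : nat)%:Z = td%:Z by [].
  by set tD := (t * D)%N => lt; nia.
- rewrite card_fseq undup_id.
    by rewrite size_allpairs cardA size_enum_ord expnSr.
  apply: allpairs_uniq; rewrite ?enum_uniq ?fset_uniq //.
  by move=> [? ?] [? ?] _ _ /f_inj.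
- move=> x y; rewrite !inE.
  move=> /allpairsP[[a d] /= [aA _ ->]] /allpairsP[[a' d'] /= [aA' _ ->]].
  rewrite fB /= => ne0.
  move=> /descends_digits[dd]; apply: Aavoid => // aa'.
  by apply: ne0; rewrite aa' dd subrr mulr0 addr0 mulr0.
Qed.

Lemma large_avoiding_set (R : realType) (r N : nat) :
  (1 < D)%N -> (0 < r)%N -> (t * D = D ^ r)%N -> (0 < N)%N ->
  exists A : {fset int},
    [/\ [set` A] `<=` int_interval N,
        D%:R^-1 * N%:R `^ (1 / r%:R) <= #|` A|%:R :> R
      & avoids_nonzero_differences A S].
Proof.
move=> D_gt1 r_gt0 tD N_gt0.
have tD_gt1 : (1 < t * D)%N by nia.
have /andP[le_N N_lt] := trunc_log_bounds tD_gt1 N_gt0.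
(* [k] is the largest exponent with [(t * D) ^ k <= N]; the maximality costs the factor [D], as
   [D ^ k.+1] is the [r]-th root of [(t * D) ^ k.+1 > N]. *)
set k := trunc_log _ _ in le_N N_lt.
have [A [Asub cardA Aavoid]] := digit_set k; exists A; split=> //.
  by move=> a /Asub; rewrite /int_interval /=; lia.
rewrite cardA ler_pdivrMl ?ltr0n // -natrM -expnS.
have -> : (D ^ k.+1)%:R = ((t * D) ^ k.+1)%:R `^ (1 / r%:R) :> R.
  rewrite tD -expnM mulnC expnM [in RHS]natrX -powR_mulrn ?ler0n // -powRrM.
  by rewrite mul1r mulfV ?pnatr_eq0 -?lt0n // powRr1 ?ler0n.
by apply: ge0_ler_powR; rewrite ?nnegrE ?ler0n ?divr_ge0 ?ler_nat // ltnW.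
Qed.

End Digits.

Theorem theorem1p3 (R : realType) :
  exists c : R, 0 < c /\
    forall N : nat, (0 < N)%N ->
      (exists A : {fset int},
         [/\ [set` A] `<=` int_interval N,
             c * N%:R `^ (1 / 2) <= #|` A|%:R
           & avoids_nonzero_differences A sums_of_two_squares]) /\
      (exists A : {fset int},
         [/\ [set` A] `<=` int_interval N,
             c * N%:R `^ (1 / 4) <= #|` A|%:R
           & avoids_nonzero_differences A sums_of_seven_fourth_powers]).
Proof.
(* The two parts give 1/3 and 1/2; the smaller constant serves both. *)
exists 3^-1; split; first by rewrite invr_gt0.
move=> N N_gt0; split.
  apply: (@large_avoiding_set _ 3 3 _ _ _ two_squares_descend R 2) => //.
  by exists 0, 0.
have [||||||| A [Asub cardA Aavoid]] :=
  @large_avoiding_set _ 8 2 _ _ _ seven_fourth_powers_descend R 4 N => //.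
  by exists (fun=> 0); rewrite big1.
exists A; split=> //; apply: le_trans cardA.
by apply: ler_wpM2r; [exact: powR_ge0 | lra].
Qed.
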